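(* Let $L_1$ and $L_2$ be finite groups with no abelian composition factors. If $L_1$ and $L_2$ are compatible, then $L_1$ and $L_2$ have compatible normal series.
   Context: All groups are finite. Two groups $L_1$ and $L_2$ are compatible if there exists a finite group $G$ with normal subgroups $N_1$ and $N_2$ such that $N_1\cong N_2$ (as abstract groups), $L_1\cong G/N_1$ and $L_2\cong G/N_2$. Two groups $L_1$ and $L_2$ have compatible normal series if, for some $\ell$, there are series of the same length $\ell$, $1=S_{0;1}\le S_{1;1}\le\cdots\le S_{\ell;1}=L_1$ and $1=S_{0;2}\le S_{1;2}\le\cdots\le S_{\ell;2}=L_2$, such that every $S_{i;1}$ is normal in $L_1$, every $S_{i;2}$ is normal in $L_2$, and $S_{i;1}/S_{i-1;1}\cong S_{i;2}/S_{i-1;2}$ for every $i\in\{1,\ldots,\ell\}$. *)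

(* Defs.v *)
From mathcomp Require Import all_boot all_fingroup all_solvable.

Set Implicit Arguments.
Unset Strict Implicit.
Unset Printing Implicit Defensive.

Local Open Scope group_scope.

(* All composition series of L have the same factors up to isomorphism and
   permutation ([JordanHolderUniqueness]); no series is singled out here. *)
Definition no_abelian_composition_factor (gT : finGroupType)
    (L : {group gT}) : Prop :=
  forall s : seq {group gT}, comps L s ->
    all (fun F : section gT => ~~ abelian F) (mkfactors L s).

Definition compatible (gT1 gT2 : finGroupType)
    (L1 : {group gT1}) (L2 : {group gT2}) : Prop :=
  exists (rT : finGroupType) (G N1 N2 : {group rT}),
    [/\ N1 <| G, N2 <| G, N1 \isog N2, L1 \isog G / N1 & L2 \isog G / N2].

(* [S 0], ..., [S l] is an ascending series of subgroups, each normal in L,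
   from 1 to L; the values of S beyond l are irrelevant. *)
Definition normal_series (gT : finGroupType) (L : {group gT})
    (l : nat) (S : nat -> {group gT}) : Prop :=
  [/\ S 0%N :=: 1, S l :=: L,
      forall i, i < l -> S i \subset S i.+1
    & forall i, i <= l -> S i <| L].

Definition compatible_normal_series (gT1 gT2 : finGroupType)
    (L1 : {group gT1}) (L2 : {group gT2}) : Prop :=
  exists (l : nat) (S1 : nat -> {group gT1}) (S2 : nat -> {group gT2}),
    [/\ normal_series L1 l S1, normal_series L2 l S2
      & forall i, i < l -> S1 i.+1 / S1 i \isog S2 i.+1 / S2 i].

(* Main.v *)
Require Import Defs.
From mathcomp Require Import all_boot all_fingroup all_solvable.

(** Write the two groups as G / N1 and G / N2, put D = N1 :&: N2, and let
    f : N1 -> N2 be an isomorphism.  Both quotients map onto G / (N1 <*> N2),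
    so only N2 / D (inside G / N1) and N1 / D (inside G / N2) have to be
    matched.  Transporting along f turns this into a question about the single
    group N = N1 with two isomorphic normal subgroups, D and D' = f^-1(D): find
    a series of characteristic subgroups S i of N whose images in N / D and in
    N / D' have isomorphic factors.  Characteristic subgroups are what is
    needed, because they remain normal in G, and so do their images under f.

    The series is built from the bottom with functorial subgroups F(N) such
    that F(N) :&: D = F(D) for every normal D (exists_matching_radical).  For
    such an F the isomorphism type of D decides the order of F(N) :&: D, hence
    also the order of the first factor F(N) / (F(N) :&: D); and D / F(D), which
    is the image of D in N / F(N), is again determined up to isomorphism, so
    that induction on N / F(N) applies (exists_matching_series).  It remains
    to choose F so that the order of the first factor determines its
    isomorphism type.  Take a simple subnormal subgroup T of N.

    If T is abelian, of order p, then F is the p-core.  The image of 'O_p(N) in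
    N / D is solvable, hence trivial as N / D has no abelian composition factor,
    and the first factor vanishes.

    If T is nonabelian, then F is the subgroup generated by the subnormal
    subgroups isomorphic to T.  Distinct ones commute
    (subnormal_simple_commute), so that F(N) is their direct product, and
    F(N) :&: D is the product of those contained in D
    (simple_layer_setI_normal).  The first factor is a direct power of T,
    which is determined by its order (simple_layer_factor_isog).

    The hypothesis on composition factors is used in the form that every
    subnormal subgroup is perfect, a property that obviously passes to normal
    subgroups and to quotients. *)

Set Implicit Arguments.
Unset Strict Implicit.
Unset Printing Implicit Defensive.

Local Open Scope group_scope.

(** * Simple subnormal subgroups *)

Section SimpleSubnormal.

Variable gT : finGroupType.
Implicit Types G H K L M N D : {group gT}.

Lemma simple_sub_or_TI G H D :
  simple H -> H \subset G -> D <| G -> (H \subset D) || (H :&: D == 1).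
Proof.
move=> /simpleP[_ simH] sHG nsDG.
have [/= -> | /= /setIidPl->] := simH _ (normalGI sHG nsDG); last by [].
by rewrite eqxx orbT.
Qed.

Lemma subnormal_simple_eq N H :
  simple N -> H <|<| N -> H :!=: 1 -> H :=: N.
Proof.
case/simpleP=> _ simN /subnormalEr[-> //|[K [/subnormal_sub sHK nsKN prKN]]].
case/negP; case: (simN K nsKN) => defK; last by rewrite defK properxx in prKN.
by rewrite -subG1 -defK.
Qed.

(** The conjugates of H by k in K stay subnormal in M, so by the last hypothesis
    H :^ k is H or centralises H.  In the second case the commutators
    [~ [~ h1^-1, k], h2] lie in L, and they equal [~ h1, h2] since h1^-1 ^ k
    commutes with H; so H^`(1) lies in H :&: L = 1. *)
Lemma norm_nonabelian_subnormal L M N H K :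
    M <| N -> H <|<| M -> L <| N -> K \subset L -> H :&: L = 1 ->
    ~~ abelian H ->
    (forall H' : {group gT}, H' <|<| M -> H' \isog H ->
      H' :=: H \/ H \subset 'C(H')) ->
  K \subset 'N(H).
Proof.
move=> nsMN snHM nsLN sKL tiHL naH cHM; apply/subsetP=> k Kk.
have Lk := subsetP sKL k Kk; have Nk := subsetP (normal_sub nsLN) k Lk.
have sHN := subset_trans (subnormal_sub snHM) (normal_sub nsMN).
have snHkM: (H :^ k)%G <|<| M.
  have nMk := subsetP (normal_norm nsMN) k Nk.
  have := morphim_subnormal (conjgm_morphism M k) snHM.
  by rewrite !morphim_conj setIid (setIidPr (subnormal_sub snHM)) (normP nMk).
have isoHk: (H :^ k)%G \isog H by rewrite isog_sym conj_isog.
have [defHk|cHHk] := cHM _ snHkM isoHk; first by rewrite inE [H :^ k]defHk.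
case/negP: naH; apply/centsP=> h1 Hh1 h2 Hh2.
pose u := [~ h1^-1, k].
have Lu: u \in L.
  rewrite /u commgEr groupMr // memJ_norm ?groupV //.
  exact: subsetP (normal_norm nsLN) _ (subsetP sHN _ Hh1).
have c1k2: (h1^-1 ^ k) ^ h2 = h1^-1 ^ k.
  apply/conjg_fixP/commgP/commute_sym/(centsP cHHk) => //.
  by rewrite memJ_conjg groupV.
have Eu: [~ u, h2] = [~ h1, h2].
  rewrite {1}commgEl {2}/u [in X in _ * X]commgEl conjMg invMg invgK c1k2.
  rewrite -mulgA invgK [h1^-1 * _]mulgA -commgEl -conjgE.
  apply/conjg_fixP/commgP; apply: (centsP cHHk); first exact: groupR.
  by rewrite memJ_conjg groupV.
have Lh: [~ h1, h2] \in L.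
  rewrite -Eu commgEl groupM ?groupV // memJ_norm //.
  exact: subsetP (normal_norm nsLN) _ (subsetP sHN _ Hh2).
apply/commgP/eqP/set1P; rewrite -[[set 1]]tiHL in_setI Lh.
by rewrite groupR.
Qed.

(** Induction on N.  If H and K are proper, they lie in proper normal subgroups
    M and L.  When one of M, L contains both, induction applies there; otherwise
    H meets L trivially and K meets M trivially, H and K normalise each other by
    the preceding lemma, and [~: H, K] lies in H :&: L = 1. *)
Lemma subnormal_simple_commute N H K :
    H <|<| N -> K <|<| N -> simple H -> simple K ->
    ~~ abelian H -> ~~ abelian K -> H :!=: K -> H \subset 'C(K).
Proof.
have [n] := ubnP #|N|; elim: n N H K => // n IHn N H K /ltnSE-leNn.
move=> snHN snKN simH simK naH naK neqHK.
have ntK : K :!=: 1 by case/simpleP: simK.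
have ntH : H :!=: 1 by case/simpleP: simH.
have [defH|[M [snHM nsMN prMN]]] := subnormalEr snHN.
  case/eqP: neqHK; rewrite defH; apply/esym/subnormal_simple_eq => //.
  by rewrite -defH.
have [defK|[L [snKL nsLN prLN]]] := subnormalEr snKN.
  case/eqP: neqHK; rewrite defK; apply/subnormal_simple_eq => //.
  by rewrite -defK.
have ltMn : #|M| < n := leq_trans (proper_card prMN) leNn.
have ltLn : #|L| < n := leq_trans (proper_card prLN) leNn.
have [sHN sKN] := (subnormal_sub snHN, subnormal_sub snKN).
have [sHL | /eqP tiHL] := orP (simple_sub_or_TI simH sHN nsLN).
  apply: (IHn L) => //; rewrite -(setIidPl sHL).
  exact: setI_subnormal (normal_sub nsLN) snHN.
have [sKM | /eqP tiKM] := orP (simple_sub_or_TI simK sKN nsMN).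
  apply: (IHn M) => //; rewrite -(setIidPl sKM).
  exact: setI_subnormal (normal_sub nsMN) snKN.
(* The induction hypothesis, in the form expected of the conjugates. *)
have cc M' H' : #|M'| < n -> H' <|<| M' -> simple H' -> ~~ abelian H' ->
  forall H'' : {group gT}, H'' <|<| M' -> H'' \isog H' ->
      H'' :=: H' \/ H' \subset 'C(H'').
  move=> ltM' snH' simH' naH' H'' snH'' isoH''.
  have [|neq] := eqVneq (H'' : {set gT}) H'; first by left.
  right; apply: (IHn M') => //; first by rewrite (isog_simple isoH'').
    by rewrite (isog_abelian isoH'').
  by rewrite eq_sym.
have [sHM sKL] := (subnormal_sub snHM, subnormal_sub snKL).
have nHK := norm_nonabelian_subnormal nsMN snHM nsLN sKL tiHL naH
               (cc _ _ ltMn snHM simH naH).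
have nKH := norm_nonabelian_subnormal nsLN snKL nsMN sHM tiKM naK
               (cc _ _ ltLn snKL simK naK).
apply/commG1P/trivgP; rewrite -tiHL subsetI commg_subl nHK.
by rewrite (subset_trans _ sKL) // commg_subr.
Qed.
End SimpleSubnormal.

(** * The layer of a simple group *)

Definition simple_components (uT : finGroupType) (T : {group uT})
    (gT : finGroupType) (A : {set gT}) : {set {group gT}} :=
  [set H : {group gT} | (H <|<| A) && (H \isog T)].

(** The analogue, for a single isomorphism type of simple groups, of the layer
    E(G), which is generated by all the components of G. *)
Definition simple_layer (uT : finGroupType) (T : {group uT})
    (gT : finGroupType) (A : {set gT}) : {set gT} :=
  <<\bigcup_(H in simple_components T A) H>>.

Section LayerFunctor.
Variables (uT : finGroupType) (T : {group uT}).

Lemma simple_layer_sub : GFunctor.closed (@simple_layer _ T).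
Proof.
move=> gT G; rewrite gen_subG; apply/bigcupsP=> H.
by rewrite inE => /andP[/subnormal_sub].
Qed.

Lemma simple_layer_cont : GFunctor.iso_continuous (@simple_layer _ T).
Proof.
move=> gT hT G f injf.
have sLG := simple_layer_sub G.
rewrite sub_morphim_pre // gen_subG; apply/bigcupsP=> H.
rewrite inE => /andP[snHG isoHT]; have sHG := subnormal_sub snHG.
rewrite -sub_morphim_pre //; apply/sub_gen/(bigcup_sup (f @* H)%G) => //.
rewrite inE morphim_subnormal //.
by rewrite -(isog_transl _ (sub_isog sHG injf)).
Qed.

Canonical simple_layer_igFun :=
  [igFun by simple_layer_sub & !simple_layer_cont].

End LayerFunctor.

Lemma simple_nonabelian_center1 (gT : finGroupType) (H : {group gT}) :
  simple H -> ~~ abelian H -> 'Z(H) = 1.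
Proof.
case/simpleP=> _ simH naH; case: (simH 'Z(H)%G) => //= [|defZ].
  exact: center_normal.
by rewrite -defZ center_abelian in naH.
Qed.

Section LayerTheory.
Variables (uT : finGroupType) (T : {group uT}).
Hypotheses (simT : simple T) (naT : ~~ abelian T).
Variable gT : finGroupType.
Implicit Types (G H K D : {group gT}).

Lemma simple_componentP G H : H \in simple_components T G ->
  [/\ H <|<| G, simple H, ~~ abelian H & H \isog T].
Proof.
rewrite inE => /andP[snHG isoHT]; split=> //.
  by rewrite (isog_simple isoHT).
by rewrite (isog_abelian isoHT).
Qed.

Lemma simple_components_commute G H K :
    H \in simple_components T G -> K \in simple_components T G -> H != K ->
  H \subset 'C(K).
Proof.
case/simple_componentP=> snHG simH naH _ /simple_componentP[snKG simK naK _].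
by move=> neqHK; apply: subnormal_simple_commute snHG snKG _ _ _ _ _.
Qed.

(** A component meets the product of the others in its centre, as it commutes
    with them; and that centre is trivial. *)
Lemma simple_layer_dprod G :
  \big[dprod/1]_(H in simple_components T G) H = simple_layer T G.
Proof.
have <- : (\prod_(H in simple_components T G) H)%G = simple_layer T G
    :> {set _}.
  by rewrite bigprodGE.
apply/eqP/(bigdprodYP (F := id)) => H cH.
have cKH : (\prod_(K in simple_components T G | K != H) K)%G \subset 'C(H).
  rewrite bigprodGE gen_subG; apply/bigcupsP=> K /andP[cK neqKH].
  exact: simple_components_commute cK cH neqKH.
rewrite subsetD cKH /= disjoint_sym disjoints_subset.
apply/subsetP=> x /setD1P[ntx Hx].
rewrite inE; apply: contra ntx => /(subsetP cKH) cHx.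
have [_ simH naH _] := simple_componentP cH.
by rewrite -in_set1 -[[set 1]](simple_nonabelian_center1 simH naH) inE Hx.
Qed.

Lemma simple_components_normal G D : D <| G ->
  simple_components T D = [set H in simple_components T G | H \subset D].
Proof.
move=> nsDG; apply/setP=> H; rewrite !inE andbC [RHS]andbAC andbC.
congr (_ && _).
apply/idP/andP=> [snHD | [snHG sHD]].
  rewrite (subnormal_trans snHD (normal_subnormal nsDG)).
  by rewrite (subnormal_sub snHD).
by rewrite -(setIidPl sHD) (setI_subnormal _ snHG) ?normal_sub.
Qed.

Lemma simple_layer_split G D : D <| G ->
  exists F : {group gT},
   \big[dprod/1]_(H in simple_components T G | ~~ (H \subset D)) H = F /\
   simple_layer T D \x F = simple_layer T G.
Proof.
move=> nsDG; have := simple_layer_dprod G.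
rewrite (bigID (fun H : {group gT} => H \subset D)) /= => defG.
have [[E F defE defF] _ _ _] := dprodP defG; exists F; split=> //.
rewrite -defG defF; congr (_ \x _); rewrite -simple_layer_dprod.
by apply: eq_bigl => H; rewrite (simple_components_normal nsDG) inE.
Qed.

(** Let F be the product of the components not contained in D.  Each of them
    meets D trivially and hence centralises F :&: D, so F :&: D is central in F;
    but F, a direct product of nonabelian simple groups, has trivial centre. *)
Lemma simple_layer_setI_normal G D :
  D <| G -> simple_layer T G :&: D = simple_layer T D.
Proof.
move=> nsDG; have [F [defF defG]] := simple_layer_split nsDG.
rewrite -(dprod_modl defG (gFsub _ _)).
suffices ->: F :&: D = 1 by rewrite dprodg1.
have sHF H : H \in simple_components T G -> ~~ (H \subset D) -> H \subset F.
  by move=> cH nsHD; rewrite -(bigdprodWY defF) sub_gen // (bigcup_max H) ?cH.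
suffices: F :&: D \subset 'Z(F).
  rewrite -(center_bigdprod defF) big1 ?subG1 => [/eqP //| H /andP[cH _]].
  have [_ simH naH _] := simple_componentP cH.
  exact: simple_nonabelian_center1.
rewrite subsetI subsetIl centsC -{1}(bigdprodWY defF) gen_subG /=.
apply/bigcupsP=> H /andP[cH nsHD].
have [snHG simH naH _] := simple_componentP cH.
have sHG := subnormal_sub snHG.
have nHF : F \subset 'N(H).
  rewrite -(bigdprodWY defF) gen_subG; apply/bigcupsP=> K /andP[cK _].
  have [-> | neqKH] := eqVneq K H; first exact: normG.
  exact/cents_norm/(simple_components_commute cK cH).
have [|/eqP tiHD] := orP (simple_sub_or_TI simH sHG nsDG).
  by rewrite (negPf nsHD).
apply/commG1P/trivgP; rewrite -tiHD subsetI commg_subl.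
rewrite (subset_trans (subsetIl _ _) nHF) /=.
rewrite (subset_trans (commgS _ (subsetIr _ _))) // commg_subr.
exact: subset_trans sHG (normal_norm nsDG).
Qed.

End LayerTheory.

Lemma isog_bigdprod_copies (uT : finGroupType) (T : {group uT})
    (gT1 gT2 : finGroupType) (s1 : seq {group gT1}) (s2 : seq {group gT2})
    (G1 : {group gT1}) (G2 : {group gT2}) :
    all (fun H : {group gT1} => H \isog T) s1 ->
    all (fun H : {group gT2} => H \isog T) s2 ->
    size s1 = size s2 ->
    \big[dprod/1]_(H <- s1) gval H = G1 ->
    \big[dprod/1]_(H <- s2) gval H = G2 ->
  G1 \isog G2.
Proof.
elim: s1 s2 G1 G2 => [|H1 s1 IHs] [|H2 s2] //= G1 G2.
  by rewrite !big_nil => _ _ _ <- <-; rewrite trivial_isog.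
case/andP=> iso1 isos1 /andP[iso2 isos2] [eq_sz].
rewrite !big_cons => def1 def2.
have [[_ K1 _ defK1] _ _ _] := dprodP def1.
have [[_ K2 _ defK2] _ _ _] := dprodP def2.
rewrite defK1 in def1; rewrite defK2 in def2.
apply: isog_dprod def1 def2 _ (IHs _ _ _ isos1 isos2 eq_sz defK1 defK2).
by rewrite (isog_transl _ iso1) isog_sym.
Qed.

(** Both factors are direct powers of T, and they have the same order because
    simple_layer T G :&: Di = simple_layer T Di and D1 is isomorphic to D2. *)
Lemma simple_layer_factor_isog (uT gT : finGroupType) (T : {group uT})
    (G D1 D2 : {group gT}) :
    simple T -> ~~ abelian T -> D1 <| G -> D2 <| G -> D1 \isog D2 ->
  simple_layer T G / (simple_layer T G :&: D1)
    \isog simple_layer T G / (simple_layer T G :&: D2).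
Proof.
move=> simT naT nsD1 nsD2 isoD; rewrite !simple_layer_setI_normal //.
have [F1 [defF1 defG1]] := simple_layer_split simT naT nsD1.
have [F2 [defF2 defG2]] := simple_layer_split simT naT nsD2.
have oD : #|simple_layer T D1| = #|simple_layer T D2|.
  exact: card_isog (gFisog (simple_layer_igFun T) isoD).
have oF : #|F1| = #|F2|.
  apply/eqP; rewrite -(eqn_pmul2l (cardG_gt0 (simple_layer T D1))) {2}oD.
  by rewrite (dprod_card defG1) (dprod_card defG2).
have quoF (D F : {group gT}) :
    simple_layer T D \x F = simple_layer T G ->
  F \isog simple_layer T G / simple_layer T D.
  move=> defG; have [_ _ cDF _] := dprodP defG.
  by apply: sdprod_isog; rewrite -dprodEsd.
apply: isog_trans (isog_symr (quoF _ _ defG1)) (isog_trans _ (quoF _ _ defG2)).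
rewrite -big_enum_cond -big_filter in defF1.
rewrite -big_enum_cond -big_filter in defF2.
set s1 := filter _ _ in defF1; set s2 := filter _ _ in defF2.
have isoT1 : all (fun H : {group gT} => H \isog T) s1.
  by apply/allP=> H; rewrite mem_filter mem_enum inE => /andP[_ /andP[]].
have isoT2 : all (fun H : {group gT} => H \isog T) s2.
  by apply/allP=> H; rewrite mem_filter mem_enum inE => /andP[_ /andP[]].
apply: (isog_bigdprod_copies isoT1 isoT2 _ defF1 defF2).
have gt1T : 1 < #|T| by rewrite cardG_gt1; case/simpleP: simT.
apply: (expnI gt1T).
(* The numbers of factors are read off from the orders, which are powers of
   #|T| > 1. *)
have oFs (s : seq {group gT}) (F : {group gT}) :
    all (fun H : {group gT} => H \isog T) s ->
    \big[dprod/1]_(H <- s) gval H = F -> (#|T| ^ size s)%N = #|F|.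
  move=> isoT /bigdprod_card <-; elim: s isoT => [|H s IHs] /=.
    by rewrite big_nil.
  by case/andP=> isoH /IHs; rewrite big_cons expnS (card_isog isoH) => ->.
by rewrite (oFs _ _ isoT1 defF1) (oFs _ _ isoT2 defF2).
Qed.

(** * Groups without abelian composition factors *)

(** Equivalent to the absence of abelian composition factors, and free of any
    choice of a composition series. *)
Definition subnormals_perfect (gT : finGroupType) (G : {group gT}) : Prop :=
  forall H : {group gT}, H <|<| G -> H^`(1) = H.

Lemma subnormals_perfect_sub (gT : finGroupType) (G K : {group gT}) :
  K <|<| G -> subnormals_perfect G -> subnormals_perfect K.
Proof.
by move=> snKG perfG H snHK; apply: perfG (subnormal_trans snHK snKG).
Qed.

Lemma morphpre_subnormal (aT rT : finGroupType) (D : {group aT})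
    (f : {morphism D >-> rT}) (H K : {group rT}) :
  K \subset f @* D -> H <|<| K -> f @*^-1 H <|<| f @*^-1 K.
Proof.
have [n] := ubnP #|K|; elim: n K => // n IHn K /ltnSE-leKn sKD /subnormalEr.
case=> [-> | [M [snHM nsMK prMK]]]; first exact: subnormal_refl.
have sMD := subset_trans (normal_sub nsMK) sKD.
apply: subnormal_trans (IHn M (leq_trans (proper_card prMK) leKn) sMD snHM) _.
by apply: normal_subnormal; rewrite morphpre_normal.
Qed.

Lemma morphim_subnormals_perfect (aT rT : finGroupType) (D G : {group aT})
    (f : {morphism D >-> rT}) :
  G \subset D -> subnormals_perfect G -> subnormals_perfect (f @* G)%G.
Proof.
move=> sGD perfG H snHfG; pose K := (f @*^-1 H :&: G)%G.
have snKG : K <|<| G.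
  have sfGD : f @* G \subset f @* D by apply: morphimS.
  apply: setI_subnormal (morphpre_subnormal sfGD snHfG).
  by rewrite -sub_morphim_pre.
have defH : f @* K = H.
  by rewrite /= setIC morphim_setIpre (setIidPr (subnormal_sub snHfG)).
by rewrite -defH -morphim_der ?perfG // (subset_trans (subnormal_sub snKG)).
Qed.

Lemma quotient_subnormals_perfect (gT : finGroupType) (G H : {group gT}) :
  G \subset 'N(H) -> subnormals_perfect G -> subnormals_perfect (G / H)%G.
Proof. exact: morphim_subnormals_perfect. Qed.

Lemma isog_subnormals_perfect (aT rT : finGroupType) (G : {group aT})
    (H : {group rT}) :
  G \isog H -> subnormals_perfect G -> subnormals_perfect H.
Proof.
case/isogP=> f _ defH /(morphim_subnormals_perfect (f := f) (subxx G)).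
by congr subnormals_perfect; apply: val_inj.
Qed.

Lemma subnormals_perfect_sol1 (gT : finGroupType) (G H : {group gT}) :
  subnormals_perfect G -> H <|<| G -> solvable H -> H :=: 1.
Proof.
move=> perfG snHG solH; apply/eqP; apply/idPn=> ntH.
by have := sol_der1_proper solH (subxx H) ntH; rewrite perfG // properxx.
Qed.

(** A composition series may start with any maximal normal subgroup M of L, so
    L / M is never abelian and M inherits the hypothesis.  If L were not
    perfect, an M containing L^`(1) would give an abelian factor; and a proper
    subnormal subgroup of L lies in some M, where induction applies. *)
Lemma no_abelian_factor_subnormals_perfect (gT : finGroupType)
    (L : {group gT}) :
  no_abelian_composition_factor L -> subnormals_perfect L.
Proof.
have [n] := ubnP #|L|; elim: n L => // n IHn L /ltnSE-leLn naL.
have perfM (M : {group gT}) : maxnormal M L L ->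
    subnormals_perfect M /\ ~~ abelian (L / M).
  move=> maxM; split.
    apply: IHn => [|s compMs].
      exact: leq_trans (proper_card (maxnormal_proper maxM)) leLn.
    have /naL : comps L (M :: s) by case/andP: compMs => lM cM; apply/and3P.
    by case/andP.
  have [s compMs] := exists_comps M.
  have /naL : comps L (M :: s) by case/andP: compMs => lM cM; apply/and3P.
  case/andP=> naF _; apply: contra naF.
  by rewrite -(isog_abelian (section_reprP (mkSec L M))).
move=> H /subnormalEr[defH | [K [snHK nsKL prKL]]].
  apply/eqP; rewrite eqEproper der_sub /=; apply/negP=> prH'.
  have [M maxM sL'M] : {M : {group gT} | maxnormal M L L & H^`(1) \subset M}.
    by apply: maxgroup_exists; rewrite -defH prH' der_norm.
  have [_ /negP[]] := perfM _ maxM.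
  by rewrite sub_der1_abelian // -defH.
have [M maxM sKM] : {M : {group gT} | maxnormal M L L & K \subset M}.
  by apply: maxgroup_exists; rewrite prKL normal_norm.
have [perf _] := perfM _ maxM; apply/perf/(subnormal_trans snHK).
apply: normal_subnormal; apply: normalS sKM (maxnormal_sub maxM) nsKL.
Qed.

(** * Isomorphisms between quotients *)

Lemma quotient_image_isog (aT rT : finGroupType) (D A : {group aT})
    (f : {morphism D >-> rT}) (K : {group rT}) :
    A \subset D -> f @* A \subset 'N(K) ->
  A / (A :&: f @*^-1 K) \isog (f @* A) / K.
Proof.
move=> sAD nKfA; pose g := [morphism of coset K \o f].
have sAg : A \subset f @*^-1 'N(K) by rewrite -sub_morphim_pre.
by have:= first_isog_loc g sAg; rewrite /= ker_comp ker_coset morphim_comp.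
Qed.

Lemma quotient_by_join_isog (gT : finGroupType) (G N1 N2 : {group gT}) :
  N1 <| G -> N2 <| G -> G / (N1 <*> N2) \isog (G / N2) / (N1 / N2).
Proof.
move=> nsN1 nsN2; have nN2 := normal_norm nsN2.
have nN12 := quotient_norms N2 (normal_norm nsN1).
have := quotient_image_isog (f := coset N2) nN2 nN12.
rewrite /= quotientYK ?(subset_trans (normal_sub nsN1)) // joingC.
by rewrite (setIidPr _) // normal_sub // normalY.
Qed.

(** * Radicals with matching factors *)

Lemma exists_simple_subnormal (gT : finGroupType) (N : {group gT}) :
  N :!=: 1 -> exists2 T : {group gT}, simple T & T <|<| N.
Proof.
move=> ntN; have [T /mingroupP[/andP[ntT snTN] minT] _] :
    {T : {group gT} | [min T | (T :!=: 1) && (T <|<| N)] & T \subset N}.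
  by apply: mingroup_exists; rewrite ntN subnormal_refl.
exists T => //; apply/simpleP; split=> // K nsKT.
have [-> | ntK] := eqVneq (K : {set gT}) 1; [by left | right].
apply: minT (normal_sub nsKT); rewrite ntK.
exact: subnormal_trans (normal_subnormal nsKT) snTN.
Qed.

(** By induction along the subnormal chain, since 'O_p(K) lies in 'O_p(G) for
    K normal in G. *)
Lemma pcore_subnormal_max (gT : finGroupType) (p : nat) (G H : {group gT}) :
  p.-group H -> H <|<| G -> H \subset 'O_p(G).
Proof.
have [n] := ubnP #|G|; elim: n G => // n IHn G /ltnSE-leGn pH snHG.
case: (subnormalEr snHG) => [defG | [K [snHK nsKG prKG]]].
  by rewrite defG in pH *; rewrite pcore_pgroup_id.
apply: subset_trans (IHn K (leq_trans (proper_card prKG) leGn) pH snHK) _.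
by rewrite -(pcore_setI_normal p nsKG) subsetIl.
Qed.

(** Quantifying over a functor, not just over a subgroup of N, is what makes
    F gT D available for the subgroups D of N. *)
Lemma exists_matching_radical (gT : finGroupType) (N : {group gT}) :
    N :!=: 1 -> exists F : GFunctor.iso_map,
  [/\ F gT N :!=: 1,
      forall D : {group gT}, D <| N -> F gT N :&: D = F gT D
    & forall D1 D2 : {group gT}, D1 <| N -> D2 <| N -> D1 \isog D2 ->
        subnormals_perfect (N / D1)%G -> subnormals_perfect (N / D2)%G ->
      F gT N / (F gT N :&: D1) \isog F gT N / (F gT N :&: D2)].
Proof.
case/exists_simple_subnormal=> T simT snTN.
have ntT : T :!=: 1 by case/simpleP: simT.
have [cTT | naT] := boolP (abelian T).
  have pr_p := simple_sol_prime (abelian_sol cTT) simT.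
  set p := #|T| in pr_p; exists [igFun of @pcore p].
  split=> /= [||D1 D2 nsD1 nsD2 _ perf1 perf2].
  - have sTO : T \subset 'O_p(N) := pcore_subnormal_max (pnat_id pr_p) snTN.
    by apply: contra ntT => /eqP O1; rewrite -subG1 -O1.
  - exact: pcore_setI_normal.
  have sOD (D : {group gT}) :
      D <| N -> subnormals_perfect (N / D)%G -> 'O_p(N) \subset D.
    move=> nsDN perf; have nDN := normal_norm nsDN.
    rewrite -quotient_sub1 ?(subset_trans (pcore_sub _ _)) //.
    have solO : solvable ('O_p(N) / D).
      exact/quotient_sol/pgroup_sol/(pcore_pgroup p N).
    have snO : ('O_p(N) / D)%G <|<| (N / D)%G.
      exact/quotient_subnormal/normal_subnormal/pcore_normal.
    by rewrite (subnormals_perfect_sol1 perf snO solO).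
  rewrite (setIidPl (sOD _ nsD1 perf1)) (setIidPl (sOD _ nsD2 perf2)).
  exact: isog_refl.
exists (simple_layer_igFun T); split=> /= [||D1 D2 nsD1 nsD2 isoD _ _].
- apply: contra ntT => /eqP L1; rewrite -subG1 -L1 sub_gen // (bigcup_max T) //.
  by rewrite inE snTN isog_refl.
- exact: simple_layer_setI_normal.
exact: simple_layer_factor_isog.
Qed.

Lemma gF_quotient_isog (F : GFunctor.iso_map) (aT rT : finGroupType)
    (D1 : {group aT}) (D2 : {group rT}) :
  D1 \isog D2 -> D1 / F aT D1 \isog D2 / F rT D2.
Proof.
case/isogP=> f injf defD2; rewrite -defD2.
have := @quotient_image_isog _ _ D1 D1 f (f @* F aT D1)%G (subxx _) _.
rewrite /= injmK ?gFsub // injmF // (setIidPr (gFsub _ _)); apply.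
exact: gFnorm.
Qed.

(** * Characteristic series with matching factors *)

(** The quotient of S i.+1 by S i.+1 :&: (S i <*> D) is, up to isomorphism, the
    factor of the image of the series in N / D, written as a section of N. *)
Definition matching_series (gT : finGroupType) (N D1 D2 : {group gT})
    (l : nat) (S : nat -> {group gT}) : Prop :=
  [/\ S 0 :=: 1, S l :=: N, forall i, i < l -> S i \subset S i.+1,
      forall i, i <= l -> S i \char N
    & forall i, i < l -> S i.+1 / (S i.+1 :&: (S i <*> D1))
                   \isog S i.+1 / (S i.+1 :&: (S i <*> D2))].

Lemma quotient_quotient_subnormals_perfect (gT : finGroupType)
    (N C D : {group gT}) :
    C <| N -> D <| N -> subnormals_perfect (N / D)%G ->
  subnormals_perfect ((N / C) / (D / C))%G.
Proof.
move=> nsCN nsDN perf; have nsYN : (D <*> C)%G <| N by rewrite normalY.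
have iso1 := third_isog (joing_subl D C) nsDN nsYN.
have iso2 := quotient_by_join_isog nsDN nsCN.
apply: isog_subnormals_perfect (isog_trans iso1 iso2) _.
exact: quotient_subnormals_perfect (quotient_norms _ (normal_norm nsYN)) perf.
Qed.

(** Factors are unchanged when a series is pulled back along N -> N / C, because
    the preimage of B contains C and thus B <*> (D / C) pulls back to its join
    with D. *)
Lemma cosetpre_factor_isog (gT : finGroupType) (N C D : {group gT})
    (A B : {group coset_of C}) :
    C <| N -> A \subset N / C -> B <| N / C -> D <| N ->
  (coset C @*^-1 A) / (coset C @*^-1 A :&: (coset C @*^-1 B <*> D))
    \isog A / (A :&: (B <*> (D / C))).
Proof.
move=> nsCN sAN nsBN nsDN; have nCN := normal_norm nsCN.
have sDC : D \subset 'N(C) := subset_trans (normal_sub nsDN) nCN.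
have nK : coset C @* (coset C @*^-1 A) \subset 'N((A :&: (B <*> (D / C)))%G).
  rewrite /= morphpreK ?sub_im_coset // normsI ?normG //.
  rewrite (subset_trans sAN) // normsY ?(normal_norm nsBN) //.
  exact/normal_norm/quotient_normal.
have sAC : coset C @*^-1 A \subset 'N(C) by apply: subsetIl.
have := quotient_image_isog (A := (coset C @*^-1 A)%G) sAC nK.
rewrite /= morphpreK ?sub_im_coset // morphpreI setIA setIid.
suffices -> : coset C @*^-1 (B <*> (D / C)) = coset C @*^-1 B <*> D by [].
rewrite -{1}(cosetpreK B) -quotientY ?subsetIl // quotientGK //.
have sCpre : C \subset coset C @*^-1 B <*> D.
  apply: subset_trans (joing_subl _ _).
  by rewrite -{1}(ker_coset C) kerE morphpreS ?sub1G.
by rewrite /normal sCpre join_subG subsetIl.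
Qed.

(** Induction on N: a radical C = F(N) is put below the preimage of a series of
    N / C.  The subgroups D1 / C and D2 / C are isomorphic since each Di / C is
    isomorphic to Di / (Di :&: C) = Di / F(Di). *)
Lemma exists_matching_series (gT : finGroupType) (N D1 D2 : {group gT}) :
    D1 <| N -> D2 <| N -> D1 \isog D2 ->
    subnormals_perfect (N / D1)%G -> subnormals_perfect (N / D2)%G ->
  exists l S, matching_series N D1 D2 l S.
Proof.
have [n] := ubnP #|N|; elim: n gT N D1 D2 => // n IHn gT N D1 D2 /ltnSE-leNn.
move=> nsD1 nsD2 isoD perf1 perf2.
have [N1 | ntN] := eqVneq (N : {set gT}) 1.
  exists 0, (fun=> 1%G); split=> //= i _.
  exact: char1.
have [F [ntFN FI isoF]] := exists_matching_radical ntN.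
have [C defC] : exists C : {group gT}, C :=: F gT N.
  by exists [group of F gT N].
rewrite -defC in ntFN FI isoF; have chC : C \char N by rewrite defC gFchar.
have nsC : C <| N := char_normal chC; have nCN := normal_norm nsC.
have isoDC (D : {group gT}) : D <| N -> D / F gT D \isog D / C.
  move=> nsDN; rewrite -FI //; apply: second_isog.
  exact: subset_trans (normal_sub nsDN) nCN.
have isoD' : (D1 / C)%G \isog (D2 / C)%G.
  apply: isog_trans (isog_symr (isoDC _ nsD1)) _.
  exact: isog_trans (gF_quotient_isog F isoD) (isoDC _ nsD2).
have ltNC : #|N / C| < n.
  exact: leq_trans (ltn_quotient ntFN (normal_sub nsC)) leNn.
have perf1' := quotient_quotient_subnormals_perfect nsC nsD1 perf1.
have perf2' := quotient_quotient_subnormals_perfect nsC nsD2 perf2.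
have [l [S' [S0 Sl incS charS isoS]]] :=
  IHn _ (N / C)%G (D1 / C)%G (D2 / C)%G ltNC (quotient_normal _ nsD1)
    (quotient_normal _ nsD2) isoD' perf1' perf2'.
pose S i : {group gT} := if i is j.+1 then (coset C @*^-1 (S' j))%G else 1%G.
have sCpre (K : {group coset_of C}) : C \subset coset C @*^-1 K.
  by rewrite -{1}(ker_coset C) kerE morphpreS ?sub1G.
have SN j : j <= l -> coset C @*^-1 (S' j) \subset N.
  move=> lej; rewrite -(quotientGK nsC) morphpreS //.
  exact: char_sub (charS _ lej).
exists l.+1, S; split=> //=.
- by rewrite Sl quotientGK.
- case=> [|i] lti /=; first exact: sub1G.
  by rewrite morphpreS ?incS.
- case=> [|i] lei /=; first exact: char1.
  apply: (@char_from_quotient _ N C) => //=; last first.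
    by rewrite cosetpreK charS.
  exact: normalS (sCpre _) (SN _ lei) nsC.
case=> [|i] lti /=.
  by rewrite S0 cosetpre1 !joing1G; apply: isoF.
have lt_il : i < l := lti.
have pull (D : {group gT}) := cosetpre_factor_isog nsC (D := D)
  (char_sub (charS _ lt_il)) (char_normal (charS _ (ltnW lt_il))).
apply: isog_trans (pull _ nsD1) _.
exact: isog_trans (isoS i lt_il) (isog_symr (pull _ nsD2)).
Qed.

(** * Compatible groups *)

Lemma compatible_normal_series_sym (gT1 gT2 : finGroupType)
    (L1 : {group gT1}) (L2 : {group gT2}) :
  compatible_normal_series L1 L2 -> compatible_normal_series L2 L1.
Proof.
case=> l [S1 [S2 [nS1 nS2 isoS]]]; exists l, S2, S1; split=> // i lti.
by rewrite isog_sym isoS.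
Qed.

Lemma compatible_normal_series_isogl (gT1 gT2 rT : finGroupType)
    (L1 : {group gT1}) (L2 : {group gT2}) (M : {group rT}) :
  M \isog L1 -> compatible_normal_series M L2 -> compatible_normal_series L1 L2.
Proof.
case/isogP=> f injf defL1 [l [S1 [S2 [[S0 Sl incS nS] nS2 isoS]]]].
exists l, (fun i => f @* S1 i)%G, S2; split=> //.
  split=> /= [||i lti|i lei]; first by rewrite S0 morphim1.
  - by rewrite Sl.
  - by rewrite morphimS ?incS.
  by rewrite -defL1 morphim_normal ?nS.
move=> i lti; apply: isog_trans (isoS i lti); rewrite isog_sym.
have sSM j : j <= l -> S1 j \subset M by move/nS/normal_sub.
have nSS : S1 i.+1 \subset 'N(S1 i).
  exact: subset_trans (sSM _ lti) (normal_norm (nS _ (ltnW lti))).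
have := quotient_image_isog (sSM _ lti) (morphim_norms f nSS).
by rewrite /= injmK ?sSM ?(ltnW lti) // (setIidPr (incS _ lti)).
Qed.

(** For subgroups A, B of N1, joining B with N2 or with N1 :&: N2 makes no
    difference inside A, by the modular law; this lets the factors computed in
    G / N2 be computed in N1 alone. *)
Lemma quotient_factor_isog (gT : finGroupType) (G N1 N2 A B : {group gT}) :
    N1 <| G -> N2 <| G -> A \subset N1 -> B \subset A -> A <| G -> B <| G ->
  (A / N2) / (B / N2) \isog A / (A :&: (B <*> (N1 :&: N2))).
Proof.
move=> nsN1 nsN2 sAN1 sBA nsA nsB.
have nN2 (X : {group gT}) : X <| G -> X \subset 'N(N2).
  by move=> nsX; apply: subset_trans (normal_sub nsX) (normal_norm nsN2).
have nBA : A / N2 \subset 'N(B / N2).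
  apply: quotient_norms; exact: subset_trans (normal_sub nsA) (normal_norm nsB).
have := quotient_image_isog (f := coset N2) (nN2 _ nsA) nBA.
rewrite isog_sym /= quotientYK ?nN2 // joingC !norm_joinEl ?nN2 //; last first.
  rewrite (subset_trans (normal_sub nsB)) // normsI ?normal_norm //.
suffices -> : A :&: B * (N1 :&: N2) = A :&: B * N2 by [].
rewrite [N1 :&: N2]setIC group_modl ?(subset_trans sBA) //.
by rewrite setIA setIAC (setIidPl sAN1).
Qed.

Definition extend_series (gT : finGroupType) (l : nat) (S : nat -> {group gT})
  (L : {group gT}) (i : nat) : {group gT} := if i <= l then S i else L.

Lemma quotient_normal_series (gT : finGroupType) (G N M : {group gT})
    (l : nat) (S : nat -> {group gT}) :
    N <| G -> M <| G -> S 0 :=: 1 -> S l :=: N ->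
    (forall i, i < l -> S i \subset S i.+1) ->
    (forall i, i <= l -> S i \char N) ->
  normal_series (G / M)%G l.+1
    (extend_series l (fun i => (S i / M)%G) (G / M)%G).
Proof.
move=> nsN nsM S0 Sl incS charS.
have nsS i : i <= l -> S i / M <| G / M.
  by move=> lei; apply/quotient_normal/(char_normal_trans (charS i lei)).
split=> [||i lti|i _]; rewrite /extend_series /=.
- by rewrite S0 quotient1.
- by rewrite ltnn.
- rewrite -ltnS lti; case: ltnP => [lt_il | _].
    by rewrite quotientS ?incS.
  by rewrite normal_sub ?nsS.
by case: leqP => // lei; rewrite ?nsS.
Qed.

(** With f : N1 -> N2 an isomorphism and S a series of N1 matching D = N1 :&: N2
    against f^-1(D), use S on the side of G / N2 and f(S) on the side of G / N1.
    Both image series stop at the image of N1 <*> N2, and one more step with the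
    common factor G / (N1 <*> N2) completes them. *)
Lemma quotient_isog_compatible (rT : finGroupType) (G N1 N2 : {group rT}) :
    N1 <| G -> N2 <| G -> N1 \isog N2 ->
    subnormals_perfect (G / N1)%G -> subnormals_perfect (G / N2)%G ->
  compatible_normal_series (G / N1)%G (G / N2)%G.
Proof.
move=> nsN1 nsN2 /isogP[f injf fN1] perf1 perf2.
pose D := (N1 :&: N2)%G.
have nsDN1 : D <| N1 := normalGI (normal_sub nsN1) nsN2.
have nsDN2 : D <| N2.
  by rewrite /= setIC; apply: normalGI (normal_sub nsN2) nsN1.
pose D2 := (f @*^-1 D)%G.
have defD : f @* D2 = D by rewrite /= morphpreK // fN1 subsetIr.
have sD2N1 : D2 \subset N1 by apply: subsetIl.
have nsD2 : D2 <| N1.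
  have defN1 : f @*^-1 N2 = N1 by rewrite -fN1 injmK.
  by rewrite -[X in _ <| X]defN1 morphpre_normal ?fN1 ?subsetIr.
have isoD : D \isog D2 by rewrite isog_sym -defD sub_isog.
(* M / (M' :&: M) is isomorphic to a normal subgroup of G / M'. *)
have perfQ (M M' : {group rT}) :
    M <| G -> M' <| G -> subnormals_perfect (G / M')%G ->
  subnormals_perfect (M / (M' :&: M))%G.
  move=> nsM nsM' perf.
  have isoM := second_isog (subset_trans (normal_sub nsM) (normal_norm nsM')).
  apply: isog_subnormals_perfect (isog_symr isoM) _.
  apply: subnormals_perfect_sub perf.
  exact/quotient_subnormal/normal_subnormal.
have perfD1 : subnormals_perfect (N1 / D)%G.
  apply: isog_subnormals_perfect (perfQ _ _ nsN1 nsN2 perf2).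
  by rewrite /= setIC isog_refl.
have perfD2 : subnormals_perfect (N1 / D2)%G.
  have perfN2 : subnormals_perfect (N2 / D)%G := perfQ _ _ nsN2 nsN1 perf1.
  apply: isog_subnormals_perfect perfN2; rewrite isog_sym /= -fN1.
  have := @quotient_image_isog _ _ N1 N1 f D (subxx _).
  rewrite fN1 (normal_norm nsDN2) (setIidPr sD2N1).
  exact.
have [l [S [S0 Sl incS charS isoS]]] :=
  exists_matching_series nsDN1 nsD2 isoD perfD1 perfD2.
have sSN1 i : i <= l -> S i \subset N1 by move/charS/char_sub.
pose fS i := (f @* S i)%G.
have charfS i : i <= l -> fS i \char N2.
  by move=> lei; rewrite /= -fN1 injm_char ?charS ?sSN1.
exists l.+1, (extend_series l (fun i => (fS i / N1)%G) (G / N1)%G),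
       (extend_series l (fun i => (S i / N2)%G) (G / N2)%G); split.
- apply: quotient_normal_series nsN2 nsN1 _ _ _ charfS => [||i lti] /=.
  + by rewrite S0 morphim1.
  + by rewrite Sl fN1.
  by rewrite morphimS ?incS.
- exact: quotient_normal_series nsN1 nsN2 S0 Sl incS charS.
move=> i lti; rewrite /extend_series -ltnS lti.
case: ltnP => [lt_il | lei]; last first.
  have -> : i = l by apply/eqP; rewrite eqn_leq lei -ltnS lti.
  rewrite /= Sl fN1.
  apply: isog_trans (isog_symr (quotient_by_join_isog nsN2 nsN1)) _.
  by rewrite joingC; apply: quotient_by_join_isog.
have le_il := ltnW lt_il.
have nsS j : j <= l -> S j <| G.
  by move=> lej; apply: char_normal_trans (charS j lej) _.
have nsfS j : j <= l -> fS j <| G.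
  by move=> lej; apply: char_normal_trans (charfS j lej) _.
have iso2 := quotient_factor_isog nsN1 nsN2 (sSN1 _ lt_il)
  (incS _ lt_il) (nsS _ lt_il) (nsS _ le_il).
have iso1 := quotient_factor_isog nsN2 nsN1 (char_sub (charfS _ lt_il))
  (morphimS f (incS _ lt_il)) (nsfS _ lt_il) (nsfS _ le_il).
apply: isog_trans iso1 _; rewrite isog_sym; apply: isog_trans iso2 _.
apply: isog_trans (isoS _ lt_il) _.
have nK : f @* S i.+1 \subset 'N((fS i.+1 :&: (fS i <*> D))%G).
  have sfSN2 := char_sub (charfS _ lt_il).
  rewrite /= normsI ?normG //; apply: normsY.
    exact: subset_trans sfSN2 (char_norm (charfS _ le_il)).
  exact: subset_trans sfSN2 (normal_norm nsDN2).
have := quotient_image_isog (sSN1 _ lt_il) nK.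
rewrite /= morphpreI injmK ?sSN1 // -[in X in f @*^-1 X]defD -morphimY ?sSN1 //.
by rewrite injmK ?join_subG ?sSN1 // setIA setIid [N2 :&: N1]setIC.
Qed.

Theorem theorem5p6 (gT1 gT2 : finGroupType)
    (L1 : {group gT1}) (L2 : {group gT2})
    (hL1 : no_abelian_composition_factor L1)
    (hL2 : no_abelian_composition_factor L2)
    (hL : compatible L1 L2) :
  compatible_normal_series L1 L2.
Proof.
have [rT [G [N1 [N2 [nsN1 nsN2 isoN iso1 iso2]]]]] := hL.
have perf1 := isog_subnormals_perfect iso1
  (no_abelian_factor_subnormals_perfect hL1).
have perf2 := isog_subnormals_perfect iso2
  (no_abelian_factor_subnormals_perfect hL2).
apply: (compatible_normal_series_isogl (isog_symr iso1)).
apply: compatible_normal_series_sym.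
apply: (compatible_normal_series_isogl (isog_symr iso2)).
apply: compatible_normal_series_sym.
exact: quotient_isog_compatible nsN1 nsN2 isoN perf1 perf2.
Qed.
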